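(* Let $d\ge2$ be even, $\alpha>0$, $\beta\in\mathbb{R}$, and let $E_3(\alpha,\beta)$ be the $d\times d$ block diagonal matrix all of whose $2\times2$ diagonal blocks equal $A=\begin{pmatrix}\alpha&\beta\\-\beta&\alpha\end{pmatrix}$. The function $\rho_3$ defined for $\xi\in\mathbb{R}^d$ by $$\rho_3(\xi)=|\xi|^{1/\alpha}$$ is an $(\mathbb{R}^d,E_3^t(\alpha,\beta))$ pseudo-norm.
   Context: $|\cdot|$ is the Euclidean norm on $\mathbb{R}^d$; $M^t$ denotes the transpose of $M$. For $a>0$ and a real square matrix $M$, $a^{M}=\exp(M\log a)$. For a real $d\times d$ matrix $M$ whose eigenvalues all have positive real parts, an $(\mathbb{R}^d,M)$ pseudo-norm is a continuous function $\rho:\mathbb{R}^d\to\mathbb{R}$ that is positive on $\mathbb{R}^d\setminus\{0\}$ and satisfies $\rho(a^{M}x)=a\rho(x)$ for all $x\in\mathbb{R}^d$, $a>0$. *)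

(* Defs.v *)
From HB Require Import structures.
From mathcomp Require Import all_boot all_order all_algebra.
From mathcomp Require Import complex.
From mathcomp Require Import all_classical all_reals all_analysis.

Set Implicit Arguments.
Unset Strict Implicit.
Unset Printing Implicit Defensive.

Import Order.TTheory GRing.Theory Num.Theory.
Import numFieldNormedType.Exports.

Local Open Scope classical_set_scope.
Local Open Scope ring_scope.

(* The library norm `|x| on matrices is the sup norm, hence this definition;
   the topologies of the two norms coincide. *)
Definition enorm (R : realType) (d : nat) (x : 'cV[R]_d) : R :=
  Num.sqrt (\sum_(i < d) x i 0 ^+ 2).

Definition expmx (R : realType) (d : nat) (M : 'M[R]_d) : 'M[R]_d :=
  lim (series (fun k : nat => (k`!%:R : R)^-1 *: M ^+ k) @ \oo).

(* a ^ M; only meaningful for 0 < a, since ln is 0 elsewhere *)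
Definition powmx (R : realType) (d : nat) (a : R) (M : 'M[R]_d) : 'M[R]_d :=
  expmx (ln a *: M).

(* The complex eigenvalues of the real matrix M.  The library's [eigenvalue]
   uses row eigenvectors, which gives the same set of eigenvalues. *)
Definition eigenvalues_Re_gt0 (R : realType) (d : nat) (M : 'M[R]_d) : Prop :=
  forall l : complex R,
    eigenvalue (map_mx (real_complex R) M) l -> 0 < complex.Re l.

(* The requirement on the eigenvalues of M, without which the notion is not
   defined, is made part of the predicate. *)
Definition is_pseudo_norm (R : realType) (d : nat) (M : 'M[R]_d)
    (rho : 'cV[R]_d -> R) : Prop :=
  [/\ eigenvalues_Re_gt0 M,
      continuous rho,
      forall x : 'cV[R]_d, x != 0 -> 0 < rho x
    & forall (x : 'cV[R]_d) (a : R), 0 < a ->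
        rho (powmx a M *m x) = a * rho x].

Definition block2 (R : realType) (alpha beta : R) : 'M[R]_2 :=
  \matrix_(i < 2, j < 2)
    if i == j then alpha
    else if (i < j)%N then beta else - beta.

(* With indices starting at 0, row i lies in the diagonal block number i./2,
   at position i %% 2 in it.  For odd d the last block would be truncated. *)
Definition E3 (R : realType) (d : nat) (alpha beta : R) : 'M[R]_d :=
  \matrix_(i < d, j < d)
    if i./2 == j./2
    then block2 alpha beta (inord (i %% 2)) (inord (j %% 2))
    else 0.

Definition rho3 (R : realType) (d : nat) (alpha : R) (xi : 'cV[R]_d) : R :=
  enorm xi `^ (1 / alpha).

(* Main.v *)
(** The transpose of [E3] is [alpha I + beta J] with [J^T = - J] and, [d] being
    even, [J^2 = - I].  Powers of [p I + q J] are those of [z = p + i q], so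
    [exp (p I + q J) = u I + v J], where [u] and [v] are the values at [t = 1]
    of the sums of [Re (z^k) t^k / k!] and [Im (z^k) t^k / k!].  Termwise
    differentiation gives [u' = p u - q v] and [v' = q u + p v], hence
    [u^2 + v^2 = exp (2 p t)]: the exponential multiplies the Euclidean norm by
    [exp p], which is [a ^ alpha] for [p = alpha ln a].  An eigenvalue [l]
    satisfies [(l - alpha)^2 = - beta^2], hence [Re l = alpha]. *)
Require Import Defs.
From mathcomp Require Import all_boot all_order all_algebra.
From mathcomp Require Import complex ring lra zify.
From mathcomp Require Import all_classical all_reals all_analysis.

Import Order.TTheory GRing.Theory Num.Theory.
Import numFieldNormedType.Exports.
Local Open Scope classical_set_scope.
Local Open Scope ring_scope.

(** The weight [w] makes the family stable under differentiation, which turns [w] into [w * z]. The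
    weights [1] and [- 'i] select the real and imaginary parts of [z ^+ k / k!]. *)
Definition exp_rot_coef {R : realType} (z w : complex R) (k : nat) : R :=
  complex.Re (w * z ^+ k) / k`!%:R.

(* The real part of [w * exp (t z)]. *)
Definition exp_rot {R : realType} (z w : complex R) (t : R) : R :=
  limn (pseries (exp_rot_coef z w) t).

Lemma norm_Re_le {R : realType} (z : complex R) : `|complex.Re z| <= Normc.normc z.
Proof.
case: z => x y /=; rewrite -sqrtr_sqr ler_wsqrtr // lerDl sqr_ge0 //.
Qed.

Lemma normc_ge0 {R : realType} (z : complex R) : 0 <= Normc.normc z.
Proof. by case: z => x y /=; exact: sqrtr_ge0. Qed.

Lemma normcX {R : realType} (z : complex R) k :
  Normc.normc (z ^+ k) = Normc.normc z ^+ k.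
Proof.
elim: k => [|k IH]; first by rewrite !expr0 Normc.normc1.
by rewrite !exprS Normc.normcM IH.
Qed.

Lemma exp_rot_cvg {R : realType} (z w : complex R) (t : R) :
  cvgn (pseries (exp_rot_coef z w) t).
Proof.
apply: normed_cvg.
apply: (@series_le_cvg _ _
  (fun k => Normc.normc w * exp_coeff (Normc.normc z * `|t|) k)).
- by move=> k /=; exact: normr_ge0.
- by move=> k; rewrite /exp_coeff /= mulr_ge0 ?normc_ge0 // divr_ge0 // exprn_ge0 //
    mulr_ge0 ?normc_ge0.
- move=> k; rewrite /exp_rot_coef /exp_coeff /= normrM normrX normrM normfV.
  rewrite [`|_%:R|]ger0_norm // exprMn -normcX mulrA mulrA -Normc.normcM mulrAC.
  by rewrite ler_wpM2r ?invr_ge0 // ler_wpM2r ?exprn_ge0 // norm_Re_le.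
- by apply: is_cvg_seriesZ; exact: is_cvg_series_exp_coeff.
Qed.

Lemma exp_rot_diffs {R : realType} (z w : complex R) :
  pseries_diffs (exp_rot_coef z w) = exp_rot_coef z (w * z).
Proof.
apply/funext => k; rewrite /pseries_diffs /exp_rot_coef exprS mulrA factS natrM.
by rewrite mulrCA invfM mulVKf.
Qed.

Lemma is_derive_exp_rot {R : realType} (z w : complex R) (t : R) :
  is_derive t 1 (exp_rot z w) (exp_rot z (w * z) t).
Proof.
rewrite /exp_rot -exp_rot_diffs.
(* Any radius larger than [|t|] would do: the series and its first two formal derivatives converge
   everywhere. *)
apply: (@pseries_snd_diffs _ _ (`|t| + 1)); rewrite ?exp_rot_diffs; try exact: exp_rot_cvg.
by rewrite [ltRHS]ger0_norm// addrC -subr_gt0 addrK.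
Qed.

Lemma exp_rot0 {R : realType} (z w : complex R) : exp_rot z w 0 = complex.Re w.
Proof.
(* The empty partial sum lacks the constant term, so [m] is taken positive. *)
apply: lim_near_cst => //; near=> m; rewrite -[m]prednK; last by near: m.
rewrite /pseries /series /= big_nat_recl //= big1 ?addr0.
  by rewrite /exp_rot_coef !expr0 !mulr1 fact0 divr1.
by move=> i _; rewrite expr0n /= mulr0.
Unshelve. all: by end_near. Qed.

Lemma exp_rot_linear {R : realType} (z w1 w2 : complex R) (a b t : R) :
  exp_rot z (a%:C%C * w1 + b%:C%C * w2) t = a * exp_rot z w1 t + b * exp_rot z w2 t.
Proof.
have h w : pseries (exp_rot_coef z w) t @ \oo --> exp_rot z w t.
  exact: exp_rot_cvg.
have -> : exp_rot z (a%:C%C * w1 + b%:C%C * w2) t =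
  limn (fun n => a * pseries (exp_rot_coef z w1) t n + b * pseries (exp_rot_coef z w2) t n).
  rewrite [LHS]/exp_rot; congr (lim (_ @ \oo)); apply/funext => n.
  rewrite /pseries /series /= !mulr_sumr -big_split; apply: eq_bigr => k _ /=.
  rewrite /exp_rot_coef mulrDl -!mulrA.
  move: (w1 * z ^+ k) (w2 * z ^+ k) => [x1 y1] [x2 y2] /=; ring.
apply: cvg_lim => //.
exact: cvgD (cvgM (cvg_cst a) (h w1)) (cvgM (cvg_cst b) (h w2)).
Qed.

Lemma exp_rot_sqr {R : realType} (p q : R) :
  exp_rot (p +i* q)%C 1 1 ^+ 2 + exp_rot (p +i* q)%C (- 'i%C) 1 ^+ 2 = expR p ^+ 2.
Proof.
set z := (p +i* q)%C.
set u := exp_rot z 1; set v := exp_rot z (- 'i%C).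
have du (t : R) : is_derive t 1 u (p * u t - q * v t).
  have := is_derive_exp_rot z 1 t.
  suff -> : exp_rot z (1 * z) t = p * u t - q * v t by [].
  (* Here [z] equals [p * 1 - q * (- 'i)], and below [- 'i * z] equals [q * 1 + p * (- 'i)];
     linearity in the weight turns both derivatives into combinations of [u] and [v]. *)
  rewrite -mulNr -exp_rot_linear; congr (exp_rot _ _ _).
  by apply/eqP; rewrite eq_complex /=; apply/andP; split; apply/eqP; ring.
have dv (t : R) : is_derive t 1 v (q * u t + p * v t).
  have := is_derive_exp_rot z (- 'i%C) t.
  suff -> : exp_rot z (- 'i%C * z) t = q * u t + p * v t by [].
  rewrite -exp_rot_linear; congr (exp_rot _ _ _).
  by apply/eqP; rewrite eq_complex /=; apply/andP; split; apply/eqP; ring.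
(* In [u u' + v v'] the terms in [q] cancel and [p (u^2 + v^2)] remains, so the exponential factor
   makes [f] constant. *)
pose f t := (u t ^+ 2 + v t ^+ 2) * expR (- (2 * p) * t).
have : f 1 = f 0.
  apply: is_derive_0_is_cst => t; rewrite /f.
  apply: trigger_derive.
  rewrite /GRing.scale /=. ring.
rewrite /f /u /v !exp_rot0 /= mulr0 expR0 mulr1 => H.
have -> : expR p ^+ 2 = expR (2 * p) by rewrite expr2 -expRD; congr expR; ring.
rewrite -[LHS]mulr1 -[X in _ * X = _](expRxMexpNx_1 (2 * p)) mulrCA; rewrite mulr1 in H.
by rewrite H; ring.
Qed.

Definition block_partner (i : nat) : nat := if odd i then i.-1 else i.+1.

(** For even [d] the last index is odd, so its partner precedes it. *)
Lemma block_partner_lt d (i : 'I_d) : ~~ odd d -> (block_partner i < d)%N.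
Proof. rewrite /block_partner; case: i => i /=; case: ifP; lia. Qed.

Lemma E3_decomp (R : realType) (d : nat) (alpha beta : R) :
  (E3 d alpha beta)^T = alpha%:M + beta *: (E3 d 0 1)^T.
Proof.
apply/matrixP => i j; rewrite !mxE.
have e2 k l : ((inord (k %% 2) : 'I_2) == inord (l %% 2)) = (odd k == odd l).
  by rewrite -val_eqE /= !inordK ?ltn_mod // !modn2; case: (odd k); case: (odd l).
have l2 k l : ((inord (k %% 2) : 'I_2) < (inord (l %% 2) : 'I_2))%N = (~~ odd k && odd l).
  by rewrite !inordK ?ltn_mod // !modn2; case: (odd k); case: (odd l).
rewrite !e2 !l2.
have [->|nij] := eqVneq i j; first by rewrite !eqxx /= mulr0 addr0.
rewrite mulr0n add0r; case: eqP => [h|_]; last by rewrite mulr0.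
case: eqP => [h'|_]; last by case: ifP; rewrite ?mulr1 ?mulrN1.
(* Equal halves and equal parities would force [i = j]. *)
by case/negP: nij; rewrite -val_eqE /= -(odd_double_half i) -(odd_double_half j) h h'.
Qed.

(** For even [d] this is a signed permutation matrix, a form in which transposition and squaring
    reduce to facts about [block_partner]. *)
Lemma E3_01E (R : realType) (d : nat) (i j : 'I_d) :
  (E3 d 0 1 : 'M[R]_d) i j = if j == block_partner i :> nat then (-1) ^+ odd i else 0.
Proof.
rewrite !mxE.
rewrite -val_eqE /= !inordK ?ltn_mod // !modn2 /block_partner.
have := odd_double_half i; have := odd_double_half j.
move: (i./2) (j./2) => a b.
case: (odd i); case: (odd j) => /= <- <-; do ?case: eqP; rewrite ?expr0 ?expr1 //; lia.
Qed.

(** The partner map is an involution that flips parity, so transposition keeps the support and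
    changes each sign. *)
Lemma E3_01_tr (R : realType) (d : nat) : (E3 d 0 1 : 'M[R]_d)^T = - E3 d 0 1.
Proof.
apply/matrixP => i j; rewrite mxE [RHS]mxE !E3_01E.
have -> : (i == block_partner j :> nat) = (j == block_partner i :> nat).
  by rewrite /block_partner; case: ifP; case: ifP; lia.
case: eqP => [->|_]; last by rewrite oppr0.
have -> : odd (block_partner i) = ~~ odd i by rewrite /block_partner; case: ifP; lia.
by case: (odd i); rewrite ?expr0 ?expr1 ?opprK.
Qed.

Lemma E3_01_sqr (R : realType) (d : nat) : ~~ odd d ->
  E3 d 0 1 *m E3 d 0 1 = - 1%:M :> 'M[R]_d.
Proof.
move=> hd; apply/matrixP => i j; rewrite !mxE.
(* Only the partner of [i] contributes to the sum; on the diagonal its two factors have opposite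
   signs. *)
rewrite (bigD1 (Ordinal (@block_partner_lt d i hd))) //= big1 ?addr0 => [|k ki]; last first.
  by by rewrite E3_01E (negbTE (ki : (k : nat) != block_partner i)) mul0r.
rewrite !E3_01E /= eqxx.
have -> : odd (block_partner i) = ~~ odd i by rewrite /block_partner; case: ifP; lia.
have -> : block_partner (block_partner i) = i by rewrite /block_partner; do ?case: ifP; lia.
rewrite eq_sym val_eqE; case: eqP => _; last by rewrite mulr0 oppr0.
by case: (odd i); rewrite ?expr0 ?expr1 ?mulr1 ?mul1r.
Qed.

Lemma rot_mxX (R : realType) (d : nat) (p q : R) (J : 'M[R]_d) k :
  J *m J = - 1%:M ->
  (p%:M + q *: J) ^+ k =
    complex.Re ((p +i* q)%C ^+ k) *: 1%:M + complex.Im ((p +i* q)%C ^+ k) *: J.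
Proof.
move=> J2; elim: k => [|k IH]; first by rewrite !expr0 /= scale1r scale0r addr0.
rewrite !exprS IH; move: (_ ^+ k) => [x y] /=.
rewrite [LHS]mulmxDl mul_scalar_mx -scalemxAl mulmxDr -!scalemxAr mulmx1 J2.
rewrite scalerDr [q *: (_ + _)]scalerDr !scalerA scalerN [X in _ + X]addrC addrACA -scaleNr -!scalerDl.
by congr (_ *: _ + _ *: _); ring.
Qed.

Lemma expmx_rot (R : realType) (d : nat) (p q : R) (J : 'M[R]_d) :
  J *m J = - 1%:M ->
  expmx (p%:M + q *: J) =
    exp_rot (p +i* q)%C 1 1 *: 1%:M + exp_rot (p +i* q)%C (- 'i%C) 1 *: J.
Proof.
move=> J2; rewrite /expmx.
set z := (p +i* q)%C.
(* The identity already holds between partial sums, so the matrix series converges because the two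
   scalar series do. *)
have -> : series (fun k : nat => (k`!%:R : R)^-1 *: (p%:M + q *: J) ^+ k) =
  (fun n => pseries (exp_rot_coef z 1) 1 n *: 1%:M +
            pseries (exp_rot_coef z (- 'i%C)) 1 n *: J).
  apply/funext => n; rewrite /pseries /series /= !scaler_suml -big_split.
  apply: eq_bigr => k _ /=; rewrite rot_mxX // scalerDr !scalerA.
  rewrite /exp_rot_coef expr1n mul1r !mulr1 -/z; congr (_ *: _ + _ *: _).
    by rewrite mulrC.
  by case: (z ^+ k) => x y /=; rewrite mulrC; congr (_ / _); ring.
apply: cvg_lim => //.
by apply: cvgD; apply: cvgZr_tmp; exact: exp_rot_cvg.
Qed.

Lemma enormE (R : realType) (d : nat) (x : 'cV[R]_d) :
  enorm x = Num.sqrt ((x^T *m x) 0 0).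
Proof.
by rewrite /enorm mxE; congr Num.sqrt; apply: eq_bigr => i _; rewrite mxE expr2.
Qed.

Lemma enorm_similarity (R : realType) (d : nat) (c : R) (M : 'M[R]_d) (x : 'cV[R]_d) :
  0 <= c -> M^T *m M = (c ^+ 2)%:M -> enorm (M *m x) = c * enorm x.
Proof.
move=> c0 H; rewrite !enormE trmx_mul mulmxA -(mulmxA x^T) H mul_mx_scalar -scalemxAl mxE.
by rewrite sqrtrM ?sqr_ge0 // sqrtr_sqr ger0_norm.
Qed.

Lemma enorm_expmx (R : realType) (d : nat) (p q : R) (J : 'M[R]_d) (x : 'cV[R]_d) :
  J^T = - J -> J *m J = - 1%:M ->
  enorm (expmx (p%:M + q *: J) *m x) = expR p * enorm x.
Proof.
move=> JT J2; apply: enorm_similarity; first exact: expR_ge0.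
rewrite expmx_rot // -(exp_rot_sqr p q); move: (exp_rot _ _ _) (exp_rot _ _ _) => u v.
(* Now [v] is the coefficient of the identity and [u] that of [J]. In [(v I - u J) (v I + u J)] the
   cross terms cancel, and [J^2 = - I] leaves [(u^2 + v^2) I]. *)
have -> : (v *: 1%:M + u *: J)^T = v *: 1%:M - u *: J.
  by apply/matrixP => i j; move/matrixP: JT => /(_ i j); rewrite !mxE eq_sym => ->; rewrite mulrN.
rewrite mulmxDr -!scalemxAr mulmx1 mulmxBl -!scalemxAl mul1mx J2.
by rewrite scalerN opprK !scalerDr !scalerN !scalerA (mulrC u v) addrA subrK
  -scalerDl scalemx1 -!expr2.
Qed.

Lemma enorm_gt0 (R : realType) (d : nat) (x : 'cV[R]_d) : x != 0 -> 0 < enorm x.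
Proof.
move=> x0; rewrite sqrtr_gt0 lt_def sumr_ge0 ?andbT => [|i _]; last exact: sqr_ge0.
apply: contraNN x0 => /eqP H; apply/eqP/matrixP => i j; rewrite ord1 mxE.
apply/eqP; rewrite -sqrf_eq0; apply/eqP.
by apply: (psumr_eq0P _ H) => // k _; exact: sqr_ge0.
Qed.

Lemma enorm_continuous (R : realType) (d : nat) : continuous (@enorm R d).
Proof.
move=> x; apply: (@continuous_comp _ _ _ (fun x : 'cV[R]_d => \sum_i x i 0 ^+ 2)).
  apply: continuous_big => [|i _ y]; first exact: add_continuous.
  by apply: (@continuous_comp _ _ _ (fun M : 'cV[R]_d => M i 0) (fun t => t ^+ 2));
    [exact: coord_continuous | exact: exprn_continuous].
exact: sqrt_continuous.
Qed.

(** A negative base would give the default value 1, hence a jump at 0. The absolute value removes it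
    and changes nothing on norms. *)
Lemma powR_norm_continuous (R : realType) (r : R) : 0 < r ->
  continuous (fun t : R => `|t| `^ r).
Proof.
move=> r0 t; have [->|t0] := eqVneq t 0.
  apply/cvgrPdist_lt => e e0; rewrite normr0 powR0 ?gt_eqF //.
  near=> s; rewrite sub0r normrN ger0_norm ?powR_ge0 //.
  (* The radius around 0 is the [r]-th root of [e]; monotonicity of the power concludes. *)
  have -> : e = (e `^ r^-1) `^ r by rewrite -powRrM mulVf ?gt_eqF // powRr1 ?ltW.
  rewrite gt0_ltr_powR ?nnegrE ?powR_ge0 //.
  near: s; apply: cvgr0_norm_lt; [|exact: powR_gt0].
  exact: cvg_id.
apply: (@continuous_comp R R R (fun s : R => `|s|) (fun s : R => s `^ r) t).
  exact: norm_continuous.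
apply/differentiable_continuous/derivable1_diffP/derivable_powR.
by rewrite in_itv /= andbT normr_gt0.
Unshelve. all: by end_near. Qed.

Lemma eigenvalues_rot (R : realType) (d : nat) (a b : R) (J : 'M[R]_d) :
  J *m J = - 1%:M -> 0 < a -> eigenvalues_Re_gt0 (a%:M + b *: J).
Proof.
move=> J2 a0 l /eigenvalueP [v vl v0].
set K := map_mx (real_complex R) J.
have K2 : K *m K = - 1%:M by rewrite -map_mxM J2 map_mxN map_mx1.
have vK : b%:C%C *: (v *m K) = (l - a%:C%C) *: v.
  move: vl; rewrite map_mxD map_mxZ map_scalar_mx mulmxDr mul_mx_scalar -scalemxAr.
  by move=> vl; rewrite scalerBl -vl addrC addKr.
have : ((l - a%:C%C) ^+ 2 + b%:C%C ^+ 2) *: v = 0.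
  rewrite scalerDl expr2 -scalerA -vK scalerA mulrC -scalerA scalemxAl -vK.
  rewrite -scalemxAl -mulmxA K2 mulmxN mulmx1 scalerA -expr2 scalerN addNr //.
move/eqP; rewrite scaler_eq0 (negbTE v0) orbF eq_complex.
case: l {vl vK} => x y /= /andP [/eqP H1 /eqP H2].
(* If [l] is real, then [(x - a)^2 + b^2 = 0] forces [x = a]. Otherwise the imaginary part
   [2 (x - a) y = 0] does. *)
have [y0|y0] := eqVneq y 0; first by rewrite y0 in H1; nra.
suff /eqP : (x - a) * y = 0 by rewrite mulf_eq0 (negbTE y0) orbF subr_eq0 => /eqP ->.
by lra.
Qed.

Theorem lemma3p3 (R : realType) (d : nat) (hd : (2 <= d)%N) (hev : ~~ odd d)
    (alpha beta : R) (halpha : 0 < alpha) :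
  is_pseudo_norm ((E3 d alpha beta)^T) (rho3 (d := d) alpha).
Proof.
set J := (E3 d 0 1 : 'M[R]_d)^T.
have JT : J^T = - J by rewrite /J E3_01_tr linearN /= E3_01_tr.
have J2 : J *m J = - 1%:M by rewrite /J E3_01_tr mulNmx mulmxN opprK E3_01_sqr.
have r0 : 0 < 1 / alpha by rewrite divr_gt0.
rewrite E3_decomp -/J; split.
- exact: eigenvalues_rot.
- have -> : rho3 alpha = (fun t : R => `|t| `^ (1 / alpha)) \o @enorm R d.
    by apply/funext => x; rewrite /rho3 /= [`|_|]ger0_norm // sqrtr_ge0.
  by move=> x; apply: continuous_comp;
    [exact: enorm_continuous | exact: powR_norm_continuous].
- by move=> x x0; rewrite powR_gt0 // enorm_gt0.
- move=> x a a0; rewrite /rho3 /powmx scalerDr scale_scalar_mx scalerA.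
  rewrite enorm_expmx // powRM ?expR_ge0 ?sqrtr_ge0 //; congr (_ * _).
  (* The norm is scaled by the power [alpha] of [a], which the exponent [1 / alpha] turns back into
     [a]. *)
  have -> : expR (ln a * alpha) = a `^ alpha by rewrite /powR gt_eqF // mulrC.
  by rewrite -powRrM mulrC divfK ?gt_eqF // powRr1 // ltW.
Qed.
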